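(* Let $Q=(X,E,r,s,\lambda)$ be a topological quiver with $X$ compact. Suppose that the $C^*$-correspondence $\mathcal E_Q$ over $C(X)$ has a finite orthonormal basis $\{u_i\}_{i=1}^n\subset C_c(E)$ and that the left action $\phi:C(X)\to\mathcal L(\mathcal E_Q)$ is injective. Let $\mathfrak I$ be the module generated by $\{u_i\}_{i=1}^n$. Then $C^*(Q)$ is the universal $C^*$-algebra generated by $C(X)$ and elements $\{S_\xi\}_{\xi\in\mathfrak I}$ satisfying the relations (1) $S_{\alpha\xi+\beta\eta}=\alpha S_\xi+\beta S_\eta$, (2) $a\cdot S_\xi\cdot b=S_{a\cdot\xi\cdot b}$, (3) $S_{u_i}^*S_{u_j}=\delta_i^j\,1\in C(X)$ for all $i,j$, and (4) $\sum_{i=1}^n S_{u_i}S_{u_i}^*=1$, for all $\alpha,\beta\in\mathbb C$, $a,b\in C(X)$ and $\xi,\eta\in\mathfrak I$. Moreover, the Toeplitz-Pimsner algebra $\mathcal T(Q):=\mathcal T(\mathcal E_Q)$ is the universal $C^*$-algebra generated by $C(X)$ and $\{S_\xi\}_{\xi\in\mathfrak I}$ satisfying (1)-(3).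
   Context: A topological quiver $Q=(X,E,r,s,\lambda)$ consists of second countable locally compact Hausdorff spaces $X$ (vertices) and $E$ (edges), continuous maps $r,s:E\to X$ with $r$ open, and a family $\lambda=\{\lambda_y\}_{y\in X}$ of Radon measures on $E$ such that $\operatorname{supp}\lambda_y=r^{-1}(y)$ for all $y\in X$ and, for each $f\in C_c(E)$, the function $y\mapsto\int_E f\,d\lambda_y$ lies in $C_c(X)$. The $C^*$-correspondence $\mathcal E_Q$ over $A=C_0(X)$ is the completion of $C_c(E)$ for the norm $\|\xi\|=\|\langle\xi,\xi\rangle\|_\infty^{1/2}$, where $\langle\xi,\eta\rangle(y)=\int_{r^{-1}(y)}\overline{\xi}\,\eta\,d\lambda_y$, with left and right actions $(a\cdot\xi\cdot b)(e)=a(s(e))\xi(e)b(r(e))$; the left action is the $*$-homomorphism $\phi:A\to\mathcal L(\mathcal E_Q)$, $\phi(a)\xi=a\cdot\xi$. For a $C^*$-correspondence $\mathcal E$ over $A$ with left action $\phi$: a representation $(T,\pi)$ of $\mathcal E$ in a $C^*$-algebra $B$ is a linear map $T:\mathcal E\to B$ and a $*$-homomorphism $\pi:A\to B$ with $T(\xi)^*T(\eta)=\pi(\langle\xi,\eta\rangle)$ and $T(\phi(a)\xi)=\pi(a)T(\xi)$. It induces $\Psi_T:\mathcal K(\mathcal E)\to B$, $\Psi_T(\theta_{\xi,\eta})=T(\xi)T(\eta)^*$, where $\theta_{\xi,\eta}(\zeta)=\xi\langle\eta,\zeta\rangle$ and $\mathcal K(\mathcal E)$ is the closed span of the $\theta_{\xi,\eta}$.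 Put $J(\mathcal E)=\phi^{-1}(\mathcal K(\mathcal E))$ and $J_{\mathcal E}=J(\mathcal E)\cap(\ker\phi)^\perp$, where $(\ker\phi)^\perp=\{a\in A: ab=0\ \forall b\in\ker\phi\}$. For a closed ideal $K$ of $J(\mathcal E)$, $(T,\pi)$ is coisometric on $K$ if $\Psi_T(\phi(a))=\pi(a)$ for all $a\in K$. The relative Cuntz-Pimsner algebra $\mathcal O(K,\mathcal E)$ is the $C^*$-algebra generated by the universal representation coisometric on $K$; $\mathcal T(\mathcal E):=\mathcal O(0,\mathcal E)$, $\mathcal O_{\mathcal E}:=\mathcal O(J_{\mathcal E},\mathcal E)$, and $C^*(Q):=\mathcal O_{\mathcal E_Q}$. A subset $\{u_i\}_{i=1}^n\subset\mathcal E$ is a basis if $\xi=\sum_i u_i\cdot\langle u_i,\xi\rangle$ for all $\xi\in\mathcal E$; it is orthonormal if also $\langle u_i,u_j\rangle=\delta_i^j 1$. Here $\delta_i^j$ is the Kronecker delta. *)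

(* Defs.v *)
From HB Require Import structures.
From mathcomp Require Import all_boot all_order all_algebra.
From mathcomp Require Import complex ring.
From mathcomp Require Import all_classical all_reals all_analysis.

Set Implicit Arguments.
Unset Strict Implicit.
Unset Printing Implicit Defensive.

Import Order.TTheory GRing.Theory Num.Theory.
Import numFieldNormedType.Exports.

Local Open Scope classical_set_scope.
Local Open Scope ring_scope.
Local Open Scope complex_scope.

HB.instance Definition _ (R : realType) := NormedModule.copy R[i] (R[i])^o.

Local Notation normc := (@Normc.normc _).

Section ComplexFacts.
Variable R : realType.
Implicit Types z w : R[i].

Lemma normcC z : `|z| = (normc z)%:C.
Proof. by []. Qed.

Lemma normc_nneg z : 0 <= normc z.
Proof. by case: z => a b; exact: sqrtr_ge0. Qed.

Lemma normcC_id (r : R) : 0 <= r -> normc r%:C = r.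
Proof. by move=> r0; rewrite /= expr0n /= addr0 sqrtr_sqr ger0_norm. Qed.

Lemma normc_conj z : normc z^* = normc z.
Proof. by case: z => a b /=; rewrite sqrrN. Qed.

Lemma normc_mul_conj z : normc (z^* * z) = normc z ^+ 2.
Proof. by rewrite Normc.normcM normc_conj expr2. Qed.

Lemma ltc_posRe (e : R[i]) : 0 < e -> e = (complex.Re e)%:C /\ 0 < complex.Re e.
Proof. by case: e => a b; rewrite ltcE /= => /andP[/eqP -> ->]. Qed.

Lemma normc_triangle z w : normc (z + w) <= normc z + normc w.
Proof. exact: le_normcD. Qed.

Lemma normc_opp z : normc (- z) = normc z.
Proof. exact: normcN. Qed.

Lemma normc_dist z w : `|normc z - normc w| <= normc (z - w).
Proof.
rewrite ler_norml; apply/andP; split.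
  have := normc_triangle (w - z) z; rewrite subrK -(normc_opp (w - z)) opprB.
  by move=> h; rewrite lerNl opprB lerBlDr.
by have := normc_triangle (z - w) w; rewrite subrK lerBlDr.
Qed.

Lemma normc_le_ReIm z : normc z <= `|complex.Re z| + `|complex.Im z|.
Proof.
have := normc_triangle (complex.Re z)%:C (0 +i* complex.Im z)%C.
rewrite [X in normc X](_ : _ = z); last first.
  by case: z => a b; congr (_ +i* _)%C; rewrite /= ?addr0 ?add0r.
move=> /le_trans; apply.
by rewrite /= !expr0n /= addr0 add0r !sqrtr_sqr.
Qed.

Lemma Re_le_normc z : `|complex.Re z| <= normc z.
Proof.
case: z => a b /=; rewrite -sqrtr_sqr ler_wsqrtr// lerDl; exact: sqr_ge0.
Qed.

Lemma Im_le_normc z : `|complex.Im z| <= normc z.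
Proof.
case: z => a b /=; rewrite -sqrtr_sqr ler_wsqrtr// lerDr; exact: sqr_ge0.
Qed.

Lemma complex_complete (F : set_system R[i]) :
  ProperFilter F -> cauchy F -> cvg F.
Proof.
move=> FF /cauchy_ballP cF.
have part (g : R[i] -> R) : (forall z w, `|g z - g w| <= normc (z - w)) ->
    cvg (g @ F).
  move=> gE.
  apply: cauchy_cvg; apply/cauchy_ballP => e e0.
  have eC0 : (0 : R[i]) < e%:C by rewrite ltcR.
  have [[A B] /= [FA FB] AB] := cF _ eC0.
  exists (g @` A, g @` B) => /=.
    split; [apply: filterS FA|apply: filterS FB] => x ?; by exists x.
  move=> [_ _] /= [[x Ax <-] [y By <-]].
  have := AB (x, y) (conj Ax By); rewrite /= -!ball_normE /=.
  rewrite normcC ltcR; exact: le_lt_trans.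
have ha : cvg (@complex.Re R @ F).
  apply: part => z w; rewrite (_ : _ - _ = complex.Re (z - w)) ?Re_le_normc//.
  by case: z; case: w.
have hb : cvg (@complex.Im R @ F).
  apply: part => z w; rewrite (_ : _ - _ = complex.Im (z - w)) ?Im_le_normc//.
  by case: z; case: w.
apply/cvg_ex; exists (lim (@complex.Re R @ F) +i* lim (@complex.Im R @ F))%C; apply/cvgrPdist_lt => e /ltc_posRe[-> e0].
have e20 : 0 < complex.Re e / 2 by rewrite divr_gt0.
move/cvgrPdist_lt/(_ _ e20): ha => ha.
move/cvgrPdist_lt/(_ _ e20): hb => hb.
apply: filterS2 ha hb => z h1 h2.
rewrite normcC ltcR (le_lt_trans (normc_le_ReIm _))//.
by rewrite (splitr (complex.Re e)); apply: ltrD; move: h1 h2; case: (z).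
Qed.

HB.instance Definition _ := Uniform_isComplete.Build R[i] complex_complete.

Lemma continuous_normcP (X : topologicalType) (f : X -> R[i]) :
  continuous f <->
  (forall x (e : R), 0 < e -> \forall y \near x, normc (f x - f y) < e).
Proof.
split=> [cf x e e0|h x].
  have eC0 : (0 : R[i]) < e%:C by rewrite ltcR.
  have /cvgrPdist_lt/(_ _ eC0) := cf x.
  by apply: filterS => y; rewrite normcC ltcR.
apply/cvgrPdist_lt => e /ltc_posRe[-> e0].
by apply: filterS (h x _ e0) => y; rewrite normcC ltcR.
Qed.

Lemma continuous_normc (X : topologicalType) (f : X -> R[i]) :
  continuous f -> continuous (fun x => normc (f x)).
Proof.
move=> /continuous_normcP cf x; apply/cvgrPdist_lt => e e0.
by apply: filterS (cf x _ e0) => y; apply: le_lt_trans; exact: normc_dist.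
Qed.

End ComplexFacts.

(* Not necessarily unital: the product is therefore not a mathcomp ring. *)
HB.mixin Record CompleteNormedModule_isCStarAlgebra (R : realType) A
    & CompleteNormedModule R[i] A := {
  cmul : A -> A -> A;
  cstar : A -> A;
  cmulA : associative cmul;
  cmulDl : left_distributive cmul +%R;
  cmulDr : right_distributive cmul +%R;
  cscaleAl : forall (k : R[i]) (a b : A), cmul (k *: a) b = k *: cmul a b;
  cscaleAr : forall (k : R[i]) (a b : A), cmul a (k *: b) = k *: cmul a b;
  cstarK : involutive cstar;
  cstarD : {morph cstar : a b / a + b};
  cstarZ : forall (k : R[i]) (a : A), cstar (k *: a) = k^* *: cstar a;
  cstarM : forall a b : A, cstar (cmul a b) = cmul (cstar b) (cstar a);
  cnormM : forall a b : A, `|cmul a b| <= `|a| * `|b|;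
  cnorm_star : forall a : A, `|cmul (cstar a) a| = `|a| ^+ 2;
}.

#[short(type="cstarType")]
HB.structure Definition CStarAlgebra (R : realType) :=
  {A of CompleteNormedModule R[i] A & CompleteNormedModule_isCStarAlgebra R A}.

Declare Scope cstar_scope.
Delimit Scope cstar_scope with CS.
Notation "a ** b" := (cmul a b) (at level 40, left associativity) : cstar_scope.
Notation "a ^#" := (cstar a) (at level 2, format "a ^#") : cstar_scope.
Local Open Scope cstar_scope.

Section C0.
Variables (R : realType) (X : topologicalType).

Definition vanishes_at_infty (f : X -> R[i]) :=
  forall e : R, 0 < e -> compact [set x | e <= normc (f x)].

Definition C0_pred : {pred X -> R[i]} :=
  fun f => `[< continuous f /\ vanishes_at_infty f >].

Record C0 := MkC0 { C0_fun :> X -> R[i]; C0_funP : C0_fun \in C0_pred }.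

HB.instance Definition _ := [isSub for C0_fun].
HB.instance Definition _ := [Choice of C0 by <:].

Lemma C0P (f : C0) : continuous f /\ vanishes_at_infty f.
Proof. by have /asboolP := C0_funP f. Qed.

Lemma mem_C0 (f : X -> R[i]) :
  continuous f -> vanishes_at_infty f -> f \in C0_pred.
Proof. by move=> ? ?; apply/asboolP. Qed.

Lemma C0_eq (f g : C0) : f =1 g -> f = g.
Proof. by move=> fg; apply/val_inj/funext. Qed.

Lemma closed_normc_ge (f : X -> R[i]) (e : R) :
  continuous f -> closed [set x | e <= normc (f x)].
Proof.
move=> /continuous_normc cf.
apply: (@preimage_closed _ _ _ [set y : R | e <= y]).
  by move=> x _; exact: cf.
exact: closed_ge.
Qed.

Lemma C0_dominated (f h : X -> R[i]) (M : R) : 0 < M -> f \in C0_pred ->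
  continuous h -> (forall x, normc (h x) <= M * normc (f x)) -> h \in C0_pred.
Proof.
move=> M0 /asboolP[cf vf] ch hf; apply: mem_C0 => // e e0.
apply: (@subclosed_compact _ _ [set x | e / M <= normc (f x)]).
- exact: closed_normc_ge.
- by apply: vf; rewrite divr_gt0.
- by move=> x /= /le_trans/(_ (hf x)); rewrite ler_pdivrMr// mulrC.
Qed.

Lemma C0_bounded (f : X -> R[i]) : f \in C0_pred ->
  exists2 M : R, 0 < M & forall x, normc (f x) <= M.
Proof.
move=> /asboolP[cf vf].
have : compact [set normc (f x) | x in [set x | 1 <= normc (f x)]].
  apply: (@continuous_compact _ _ (fun x => normc (f x))); last exact: vf ltr01.
  exact/continuous_subspaceT/continuous_normc.
move=> /compact_bounded[M [_ /(_ (M + 1)) hM0]].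
have {hM0}hM := hM0 (ltr_pwDr ltr01 (lexx M)).
exists (Num.max 1 (M + 1)); first by rewrite lt_max ltr01.
move=> x; rewrite le_max; case: (leP (normc (f x)) 1) => //= /ltW fx.
by have := hM (normc (f x)) (ex_intro2 _ _ x fx erefl);
   rewrite /= ger0_norm ?normc_nneg.
Qed.

Lemma C0_submod_closed : submod_closed C0_pred.
Proof.
have C0D (f g : X -> R[i]) :
    f \in C0_pred -> g \in C0_pred -> f + g \in C0_pred.
  move=> /asboolP[cf vf] /asboolP[cg vg].
  have cfg : continuous (f + g) by move=> x; apply: cvgD; [exact: cf|exact: cg].
  apply: mem_C0 => // e e0; have e20 : 0 < e / 2 by rewrite divr_gt0.
  apply: (@subclosed_compact _ _ ([set x | e / 2 <= normc (f x)] `|`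
                                  [set x | e / 2 <= normc (g x)])).
  - exact: closed_normc_ge.
  - exact: (compactU (vf _ e20) (vg _ e20)).
  - move=> x /= h; have := le_trans h (normc_triangle _ _).
    case: (leP (e / 2) (normc (f x))) => hf; first by left.
    case: (leP (e / 2) (normc (g x))) => hg; first by right.
    by rewrite leNgt [ltRHS]splitr ltrD.
split.
  apply: mem_C0; first exact: cst_continuous.
  move=> e e0; rewrite (_ : mkset _ = set0) ?eqEsubset; last first.
    split=> // x h; have {h} : e <= normc (0 : R[i]) := h.
    by rewrite Normc.normc0 leNgt e0.
  exact: compact0.
move=> k f g f0 g0; apply: C0D => //.
apply: (@C0_dominated f _ (normc k + 1)) => //.
- by rewrite ltr_wpDl ?normc_nneg.
- move=> x; apply: continuousZl_tmp; have /asboolP[cf _] := f0; exact: cf.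
- move=> x; rewrite /= Normc.normcM ler_wpM2r ?normc_nneg// lerDl.
  exact: ler01.
Qed.

HB.instance Definition _ :=
  GRing.isSubmodClosed.Build R[i] (X -> R[i]) C0_pred C0_submod_closed.
HB.instance Definition _ := [SubChoice_isSubLmodule of C0 by <:].

Definition C0_norm (f : C0) : R := sup (range (fun x => normc (f x))).

Lemma C0_norm_ub (f : C0) x : normc (f x) <= C0_norm f.
Proof.
have [M _ hM] := C0_bounded (C0_funP f).
by apply: ub_le_sup; [exists M => _ [y _ <-]; exact: hM|exists x].
Qed.

Lemma C0_norm_le (f : C0) (M : R) :
  0 <= M -> (forall x, normc (f x) <= M) -> C0_norm f <= M.
Proof.
move=> M0 hM; have [[x _]|/nonemptyPn] := pselect ([set: X] !=set0); last first.
  by rewrite /C0_norm => ->; rewrite image_set0 sup0.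
apply: ge_sup; first by exists (normc (f x)); exists x.
by move=> _ [y _ <-]; exact: hM.
Qed.

Lemma C0_norm_ge0 (f : C0) : 0 <= C0_norm f.
Proof.
have [[x _]|/nonemptyPn] := pselect ([set: X] !=set0).
  exact: le_trans (normc_nneg _) (C0_norm_ub f x).
by rewrite /C0_norm => ->; rewrite image_set0 sup0.
Qed.

Let C0_normC (f : C0) : R[i] := (C0_norm f)%:C.

Let C0_ler_normD (f g : C0) : C0_normC (f + g) <= C0_normC f + C0_normC g.
Proof.
rewrite -rmorphD lecR; apply: C0_norm_le => [|x].
  by rewrite addr_ge0 ?C0_norm_ge0.
by apply: (le_trans (normc_triangle _ _)); rewrite lerD ?C0_norm_ub.
Qed.

Let C0_norm_leZ (k : R[i]) (f : C0) : C0_norm (k *: f) <= normc k * C0_norm f.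
Proof.
apply: C0_norm_le => [|x]; first by rewrite mulr_ge0 ?normc_nneg ?C0_norm_ge0.
by rewrite /= Normc.normcM ler_wpM2l ?normc_nneg ?C0_norm_ub.
Qed.

Let C0_normrZ (k : R[i]) (f : C0) : C0_normC (k *: f) = `|k| * C0_normC f.
Proof.
rewrite normcC -rmorphM; congr (_%:C); apply/le_anti; rewrite C0_norm_leZ /=.
have [->|k0] := eqVneq k 0; first by rewrite Normc.normc0 mul0r C0_norm_ge0.
have nk0 : 0 < normc k.
  rewrite lt_neqAle normc_nneg andbT eq_sym; apply: contra_neq k0.
  exact: Normc.eq0_normc.
have := C0_norm_leZ k^-1 (k *: f).
by rewrite scalerA mulVf// scale1r Normc.normcV ler_pdivlMl.
Qed.

Let C0_normr0_eq0 (f : C0) : C0_normC f = 0 -> f = 0.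
Proof.
move=> [f0]; apply: C0_eq => x; apply: Normc.eq0_normc; apply/le_anti.
by rewrite normc_nneg -f0 C0_norm_ub.
Qed.

HB.instance Definition _ :=
  Lmodule_isNormed.Build R[i] C0 C0_ler_normD C0_normrZ C0_normr0_eq0.

Lemma C0_normE (f : C0) : `|f| = (C0_norm f)%:C.
Proof. by []. Qed.

Lemma C0_complete (F : set_system C0) : ProperFilter F -> cauchy F -> cvg F.
Proof.
move=> FF /cauchy_ballP cF.
have cFR (e : R) : 0 < e -> exists2 A : set C0, F A &
    forall f g, A f -> A g -> forall x, normc (f x - g x) < e.
  move=> e0; have eC0 : (0 : R[i]) < e%:C by rewrite ltcR.
  have [[A B] /= [FA FB] AB] := cF _ eC0.
  exists (A `&` B); first exact: filterI.
  move=> f g [Af _] [_ Bg] x; have := AB (f, g) (conj Af Bg).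
  rewrite /= -ball_normE /= C0_normE ltcR; apply: le_lt_trans.
  exact: (C0_norm_ub (f - g) x).
have ev_cvg x : cvg ((fun f : C0 => f x) @ F).
  apply: cauchy_cvg; apply/cauchy_ballP => e /ltc_posRe[-> e0].
  have [A FA hA] := cFR _ e0; exists ((fun f : C0 => f x) @` A,
    (fun f : C0 => f x) @` A) => /=.
    by split; apply: (@filterS _ F _ A) => // f Af; exists f.
  move=> [_ _] /= [[f Af <-] [g Ag <-]].
  by rewrite -ball_normE /= normcC ltcR; exact: hA.
pose h x := lim ((fun f : C0 => f x) @ F).
have unif (e : R) : 0 < e -> exists2 A : set C0, F A &
    forall f, A f -> forall x, normc (h x - f x) < e.
  move=> e0; have e20 : 0 < e / 2 by rewrite divr_gt0.
  have [A FA hA] := cFR _ e20; exists A => // f Af x.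
  have eC20 : (0 : R[i]) < (e / 2)%:C by rewrite ltcR.
  have /cvgrPdist_lt/(_ _ eC20) Fx := ev_cvg x.
  have [g [Ag]] := filter_ex (filterI FA Fx).
  rewrite normcC ltcR => hg.
  rewrite -(subrK (g x) (h x)) -addrA (le_lt_trans (normc_triangle _ _))//.
  by rewrite [ltRHS]splitr ltrD ?hA.
have ch : continuous h.
  apply/continuous_normcP => x e e0.
  have e30 : 0 < e / 3 by rewrite divr_gt0.
  have [A FA hA] := unif _ e30; have [f Af] := filter_ex FA.
  have [/continuous_normcP cf _] := C0P f.
  apply: filterS (cf x _ e30) => y fxy.
  have -> : h x - h y = (h x - f x) + ((f x - f y) + (f y - h y)).
    by rewrite [X in _ = _ + X]addrA subrK addrA subrK.
  apply: (le_lt_trans (normc_triangle _ _)).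
  have -> : e = e / 3 + (e / 3 + e / 3) by field.
  apply: ltrD; first exact: hA.
  apply: (le_lt_trans (normc_triangle _ _)); apply: ltrD => //.
  by rewrite -normc_opp opprB hA.
have h0 : vanishes_at_infty h.
  move=> e e0; have e20 : 0 < e / 2 by rewrite divr_gt0.
  have [A FA hA] := unif _ e20; have [f Af] := filter_ex FA.
  have [_ vf] := C0P f.
  apply: (@subclosed_compact _ _ [set x | e / 2 <= normc (f x)]).
  - exact: closed_normc_ge.
  - exact: vf.
  - move=> x /= hx; rewrite leNgt; apply/negP => fx.
    have := normc_triangle (h x - f x) (f x); rewrite subrK => /(le_trans hx).
    by apply/negP; rewrite -ltNge [ltRHS]splitr ltrD ?hA.
apply/cvg_ex; exists (MkC0 (mem_C0 ch h0)).
apply/cvgrPdist_lt => e /ltc_posRe[-> e0].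
have e20 : 0 < complex.Re e / 2 by rewrite divr_gt0.
have [A FA hA] := unif _ e20; apply: filterS FA => f Af.
rewrite C0_normE ltcR (@le_lt_trans _ _ (complex.Re e / 2))//.
  by apply: C0_norm_le => [|x]; [exact: ltW|apply/ltW/hA].
by rewrite ltr_pdivrMr// ltr_pMr// ltr1n.
Qed.

HB.instance Definition _ := Uniform_isComplete.Build C0 C0_complete.

Lemma C0_mul_subproof (f g : C0) : (fun x => f x * g x) \in C0_pred.
Proof.
have [M M0 hM] := C0_bounded (C0_funP g).
apply: (C0_dominated M0 (C0_funP f)) => x.
  by apply: cvgM; [exact: (C0P f).1|exact: (C0P g).1].
by rewrite Normc.normcM mulrC ler_wpM2r ?normc_nneg.
Qed.

Definition C0_mul (f g : C0) : C0 := MkC0 (C0_mul_subproof f g).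

Lemma C0_star_subproof (f : C0) : (fun x => (f x)^*) \in C0_pred.
Proof.
have [cf _] := C0P f.
apply: (C0_dominated ltr01 (C0_funP f)); last first.
  by move=> x; rewrite normc_conj mul1r.
apply/continuous_normcP => x e e0.
move/continuous_normcP: cf => /(_ x e e0); apply: filterS => y.
by rewrite -rmorphB normc_conj.
Qed.

Definition C0_star (f : C0) : C0 := MkC0 (C0_star_subproof f).

Let C0_normM (f g : C0) : `|C0_mul f g| <= `|f| * `|g|.
Proof.
rewrite !C0_normE -rmorphM lecR; apply: C0_norm_le => [|x].
  by rewrite mulr_ge0 ?C0_norm_ge0.
by rewrite /= Normc.normcM ler_pM ?normc_nneg ?C0_norm_ub.
Qed.

Let C0_norm_star (f : C0) : `|C0_mul (C0_star f) f| = `|f| ^+ 2.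
Proof.
rewrite !C0_normE -rmorphXn; congr (_%:C).
set g := C0_mul _ _; apply/le_anti/andP; split.
  apply: C0_norm_le => [|x]; first exact: sqr_ge0.
  by rewrite /= normc_mul_conj lerXn2r ?nnegrE ?normc_nneg ?C0_norm_ge0 ?C0_norm_ub.
rewrite -[leRHS]sqr_sqrtr ?C0_norm_ge0// lerXn2r ?nnegrE ?C0_norm_ge0 ?sqrtr_ge0//.
apply: C0_norm_le => [|x]; first exact: sqrtr_ge0.
rewrite -[leLHS]ger0_norm ?normc_nneg// -sqrtr_sqr ler_wsqrtr//.
by rewrite -normc_mul_conj; exact: (C0_norm_ub g x).
Qed.

Let C0_mulA : associative C0_mul.
Proof. by move=> f g h; apply: C0_eq => x; exact: mulrA. Qed.

Let C0_mulDl : left_distributive C0_mul +%R.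
Proof. by move=> f g h; apply: C0_eq => x; exact: mulrDl. Qed.

Let C0_mulDr : right_distributive C0_mul +%R.
Proof. by move=> f g h; apply: C0_eq => x; exact: mulrDr. Qed.

Let C0_scaleAl (k : R[i]) (f g : C0) : C0_mul (k *: f) g = k *: C0_mul f g.
Proof. by apply: C0_eq => x; rewrite /= -mulrA. Qed.

Let C0_scaleAr (k : R[i]) (f g : C0) : C0_mul f (k *: g) = k *: C0_mul f g.
Proof. by apply: C0_eq => x; exact: mulrCA. Qed.

Let C0_starK : involutive C0_star.
Proof. by move=> f; apply: C0_eq => x; exact: conjcK. Qed.

Let C0_starD : {morph C0_star : f g / f + g}.
Proof. by move=> f g; apply: C0_eq => x; exact: (rmorphD conjc). Qed.

Let C0_starZ (k : R[i]) (f : C0) : C0_star (k *: f) = k^* *: C0_star f.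
Proof. by apply: C0_eq => x; exact: (rmorphM conjc). Qed.

Let C0_starM (f g : C0) : C0_star (C0_mul f g) = C0_mul (C0_star g) (C0_star f).
Proof. by apply: C0_eq => x; rewrite /= mulrC rmorphM. Qed.

HB.instance Definition _ := CompleteNormedModule_isCStarAlgebra.Build R C0
  C0_mulA C0_mulDl C0_mulDr C0_scaleAl C0_scaleAr C0_starK C0_starD C0_starZ
  C0_starM C0_normM C0_norm_star.

Lemma C0_one_subproof : compact [set: X] -> (fun=> 1 : R[i]) \in C0_pred.
Proof.
move=> cX; apply: mem_C0; first exact: cst_continuous.
move=> e e0; apply: (@subclosed_compact _ _ setT) => //.
exact/closed_normc_ge/cst_continuous.
Qed.

Definition C0_one (cX : compact [set: X]) : C0 := MkC0 (C0_one_subproof cX).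

End C0.

Section StarHom.
Variables (R : realType) (A B : cstarType R).

Definition star_hom (f : A -> B) : Prop :=
  [/\ linear f, {morph f : a b / a ** b} & {morph f : a / a^#}].

End StarHom.

Section Generation.
Variables (R : realType) (B : cstarType R).

Definition cstar_subalgebra (D : set B) : Prop :=
  [/\ closed D, D 0,
      forall (k : R[i]) a b, D a -> D b -> D (k *: a + b),
      forall a b, D a -> D b -> D (a ** b)
    & forall a, D a -> D a^#].

Definition generates (G : set B) : Prop :=
  forall D : set B, cstar_subalgebra D -> G `<=` D -> D = setT.

Definition cpositive (a : B) : Prop := exists b : B, a = b^# ** b.

End Generation.

(* The last two axioms on lact say that a |-> lact a is a *-homomorphism into *)
(* the adjointable operators; such operators are automatically bounded and    *)
(* (right) A-linear.                                                          *)
Record correspondence (R : realType) (A : cstarType R) := Correspondence {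
  corr_sort :> completeNormedModType R[i];
  ract : corr_sort -> A -> corr_sort;
  inner : corr_sort -> corr_sort -> A;
  lact : A -> corr_sort -> corr_sort;
  ract_linearl : forall a, linear (fun xi => ract xi a);
  ract_linearr : forall xi, linear (ract xi);
  ractA : forall xi a b, ract (ract xi a) b = ract xi (a ** b);
  inner_linear : forall xi, linear (inner xi);
  inner_ract : forall xi eta a, inner xi (ract eta a) = inner xi eta ** a;
  inner_star : forall xi eta, (inner xi eta)^# = inner eta xi;
  inner_ge0 : forall xi, cpositive (inner xi xi);
  inner_norm : forall xi, `|inner xi xi| = `|xi| ^+ 2;
  lact_linear : forall xi, linear (fun a => lact a xi);
  lactM : forall a b xi, lact (a ** b) xi = lact a (lact b xi);
  lact_star : forall a xi eta,
    inner (lact a xi) eta = inner xi (lact a^# eta);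
}.

Section Correspondence.
Variables (R : realType) (A : cstarType R) (E : correspondence A).

Definition adjoint_of (k k' : E -> E) : Prop :=
  forall xi eta, inner (k xi) eta = inner xi (k' eta).

Definition theta (xi eta : E) : E -> E := fun zeta => ract xi (inner eta zeta).

Definition theta_span (k : E -> E) : Prop :=
  exists (n : nat) (c : 'I_n -> R[i]) (xi eta : 'I_n -> E),
    k = (fun zeta => \sum_(i < n) c i *: theta (xi i) (eta i) zeta).

(* The closed span is taken for the operator norm. *)
Definition compact_op (k : E -> E) : Prop :=
  (exists k', adjoint_of k k') /\
  forall e : R, 0 < e -> exists2 f, theta_span f &
    forall zeta, `|k zeta - f zeta| <= e%:C * `|zeta|.

Definition J_ideal : set A := [set a | compact_op (lact a)].

Definition ker_lact : set A := [set a | forall xi : E, lact a xi = 0].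

Definition katsura_ideal : set A :=
  J_ideal `&` [set a | forall b, ker_lact b -> a ** b = 0].

Definition orthonormal_basis (e : A) (n : nat) (u : 'I_n -> E) : Prop :=
  (forall xi, xi = \sum_(i < n) ract (u i) (inner (u i) xi)) /\
  (forall i j, inner (u i) (u j) = (i == j)%:R *: e).

Definition generated_module (G : set E) : set E :=
  [set xi | forall D : set E,
     G `<=` D -> D 0 ->
     (forall (k : R[i]) x y, D x -> D y -> D (k *: x + y)) ->
     (forall a x, D x -> D (lact a x)) ->
     (forall a x, D x -> D (ract x a)) -> D xi].

Section Representations.
Variable B : cstarType R.
Implicit Types (T : E -> B) (pi : A -> B).

Definition representation T pi : Prop :=
  [/\ linear T, star_hom pi,
      forall xi eta, (T xi)^# ** T eta = pi (inner xi eta)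
    & forall a xi, T (lact a xi) = pi a ** T xi].

(* Psi restricts to the *-homomorphism K(E) -> B with                         *)
(* Psi(theta_{xi,eta}) = T(xi) T(eta)^*; its values outside K(E) are junk.    *)
(* On K(E) these conditions determine Psi, *-homomorphisms of C*-algebras     *)
(* being continuous, and for a representation such a Psi always exists.       *)
Definition induced_hom T (Psi : (E -> E) -> B) : Prop :=
  [/\ forall (c : R[i]) k l, compact_op k -> compact_op l ->
        Psi (fun zeta => c *: k zeta + l zeta) = c *: Psi k + Psi l,
      forall k l, compact_op k -> compact_op l -> Psi (k \o l) = Psi k ** Psi l,
      forall k k', compact_op k -> compact_op k' -> adjoint_of k k' ->
        Psi k' = (Psi k)^#
    & forall xi eta, Psi (theta xi eta) = T xi ** (T eta)^#].

Definition coisometric (K : set A) T pi : Prop :=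
  exists2 Psi, induced_hom T Psi & forall a, K a -> Psi (lact a) = pi a.

End Representations.

(* (O, T, pi) is the relative Cuntz-Pimsner algebra O(K, E) together with its *)
(* universal representation.                                                  *)
Definition is_relative_cuntz_pimsner (K : set A)
    (O : cstarType R) (T : E -> O) (pi : A -> O) : Prop :=
  [/\ representation T pi, coisometric K T pi,
      generates (range T `|` range pi)
    & forall (B : cstarType R) (T' : E -> B) (pi' : A -> B),
        representation T' pi' -> coisometric K T' pi' ->
        exists! rho : O -> B,
          [/\ star_hom rho, forall xi, rho (T xi) = T' xi
            & forall a, rho (pi a) = pi' a]].

Definition is_toeplitz_pimsner := is_relative_cuntz_pimsner [set 0].

Definition is_cuntz_pimsner := is_relative_cuntz_pimsner katsura_ideal.

(* (O, pi, S) is the universal C*-algebra generated by A and elements S_xi,   *)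
(* xi in J, subject to rel. A C*-algebra "generated by A" comes with a        *)
(* *-homomorphism pi from A, which is part of rel below; only the values of   *)
(* S on J matter.                                                             *)
Definition is_universal_algebra (J : set E)
    (rel : forall B : cstarType R, (A -> B) -> (E -> B) -> Prop)
    (O : cstarType R) (pi : A -> O) (S : E -> O) : Prop :=
  [/\ rel O pi S,
      generates (range pi `|` S @` J)
    & forall (B : cstarType R) (pi' : A -> B) (S' : E -> B), rel B pi' S' ->
        exists! rho : O -> B,
          [/\ star_hom rho, forall a, rho (pi a) = pi' a
            & forall xi, J xi -> rho (S xi) = S' xi]].

(* Here e is the unit of A, and pi e is therefore the unit of the C*-algebra  *)
(* generated by pi(A) and the S_xi.                                           *)
Definition toeplitz_relations (e : A) (n : nat) (u : 'I_n -> E)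
    (B : cstarType R) (pi : A -> B) (S : E -> B) : Prop :=
  let J := generated_module (range u) in
  [/\ star_hom pi,
      forall (alpha beta : R[i]) xi eta, J xi -> J eta ->
        S (alpha *: xi + beta *: eta) = alpha *: S xi + beta *: S eta,
      forall a b xi, J xi -> pi a ** S xi ** pi b = S (lact a (ract xi b))
    & forall i j, (S (u i))^# ** S (u j) = pi ((i == j)%:R *: e)].

Definition cuntz_relations (e : A) (n : nat) (u : 'I_n -> E)
    (B : cstarType R) (pi : A -> B) (S : E -> B) : Prop :=
  toeplitz_relations e u pi S /\
  \sum_(i < n) S (u i) ** (S (u i))^# = pi e.

End Correspondence.

Arguments toeplitz_relations {R A E} e {n} u B pi S.
Arguments cuntz_relations {R A E} e {n} u B pi S.

Section Borel.
Variables (R : realType) (E : topologicalType).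

(* The Borel sigma-algebra of E, carried by option E: measurable types are    *)
(* inhabited, whereas E may be empty. A Borel measure on E is a measure on    *)
(* borel_space for which the extra point None is negligible.                  *)
Definition borel_space :=
  g_sigma_algebraType [set Some @` U | U in (@open E : set (set E))].

Implicit Type mu : {measure set borel_space -> \bar R}.

Local Open Scope ereal_scope.

Definition radon mu : Prop :=
  [/\ mu [set None] = 0,
      forall K : set E, compact K -> mu (Some @` K) < +oo,
      forall B : set E, measurable (Some @` B : set borel_space) ->
        mu (Some @` B) =
        ereal_inf [set mu (Some @` U) | U in [set U | open U /\ B `<=` U]]
    & forall U : set E, open U ->
        mu (Some @` U) =
        ereal_sup [set mu (Some @` K) | K in [set K | compact K /\ K `<=` U]]].

Definition supp mu : set E :=
  [set x | forall U : set E, open U -> U x -> 0 < mu (Some @` U)].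

Local Close Scope ereal_scope.

Definition cintegral mu (D : set E) (f : E -> R[i]) : R[i] :=
  ((\int[mu]_(x in Some @` D) complex.Re (oapp f 0 x)) +i*
   (\int[mu]_(x in Some @` D) complex.Im (oapp f 0 x)))%C.

Definition Cc (f : E -> R[i]) : Prop :=
  continuous f /\ compact (closure [set x | f x != 0]).

End Borel.

Record topological_quiver (R : realType) := TopologicalQuiver {
  vertex : topologicalType;
  edge : topologicalType;
  qr : edge -> vertex;
  qs : edge -> vertex;
  lam : vertex -> {measure set (borel_space edge) -> \bar R};
  vertex_sc : @second_countable vertex;
  vertex_lc : locally_compact [set: vertex];
  vertex_hausdorff : hausdorff_space vertex;
  edge_sc : @second_countable edge;
  edge_lc : locally_compact [set: edge];
  edge_hausdorff : hausdorff_space edge;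
  qr_cont : continuous qr;
  qs_cont : continuous qs;
  qr_open : forall U : set edge, open U -> open (qr @` U);
  lam_radon : forall y, radon (lam y);
  lam_supp : forall y, supp (lam y) = qr @^-1` [set y];
  lam_Cc : forall f : edge -> R[i], Cc f ->
    Cc (fun y => cintegral (lam y) setT f);
}.

(* iota : C_c(E) -> EQ exhibits EQ as the C*-correspondence of Q, that is the *)
(* completion of C_c(E); iota is only specified on C_c(E). It is isometric    *)
(* for the norm of C_c(E) by inner_norm.                                      *)
Record is_quiver_correspondence (R : realType) (Q : topological_quiver R)
    (EQ : correspondence (C0 R (vertex Q))) (iota : (edge Q -> R[i]) -> EQ) :
    Prop := IsQuiverCorrespondence {
  iota_linear : forall (k : R[i]) xi eta, Cc xi -> Cc eta ->
    iota (k *: xi + eta) = k *: iota xi + iota eta;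
  iota_inner : forall xi eta, Cc xi -> Cc eta -> forall y,
    inner (iota xi) (iota eta) y =
    cintegral (lam y) (@qr R Q @^-1` [set y]) (fun e => (xi e)^* * eta e);
  iota_lact : forall a xi, Cc xi ->
    lact a (iota xi) = iota (fun e => a (qs e) * xi e);
  iota_ract : forall xi b, Cc xi ->
    ract (iota xi) b = iota (fun e => xi e * b (qr e));
  iota_dense : dense (iota @` [set xi | Cc xi]);
}.

(* Main.v *)
Require Import Defs.
From HB Require Import structures.
From mathcomp Require Import all_boot all_order all_algebra.
From mathcomp Require Import complex.
From mathcomp Require Import all_classical all_reals all_analysis.

Local Open Scope classical_set_scope.
Local Open Scope ring_scope.

(** Because of the expansion xi = sum_i u_i <u_i, xi>, the module generated by
    the u_i is all of the correspondence E, and every adjointable operator k is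
    the finite sum of the theta_(k u_i, u_i). So K(E) contains the image of phi,
    and injectivity of phi makes the Katsura ideal all of C(X). On operators,
    Psi_T must be k |-> sum_i T(k u_i) T(u_i)^*; hence Psi_T (phi(a)) =
    pi(a) sum_i T(u_i) T(u_i)^*, and coisometry on C(X) is relation (4).
    Expanding both arguments in the basis shows that (1)-(3) amount to being a
    representation. *)

Import Order.TTheory GRing.Theory Num.Theory.
Local Open Scope cstar_scope.

(** * Maps known to be linear only through the predicate [linear] *)

Section LinearProp.
Context {K : pzRingType} {V W : lmodType K} {f : V -> W} (f_lin : linear f).

Lemma linearP_add : {morph f : x y / x + y}.
Proof. by move=> x y; have := f_lin 1 x y; rewrite !scale1r. Qed.

Lemma linearP_zero : f 0 = 0.
Proof. by have := f_lin (-1) 0 0; rewrite !scaleN1r !addNr. Qed.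

Lemma linearP_scale (c : K) x : f (c *: x) = c *: f x.
Proof. by have := f_lin c x 0; rewrite linearP_zero !addr0. Qed.

Lemma linearP_opp : {morph f : x / - x}.
Proof. by move=> x; rewrite -scaleN1r linearP_scale scaleN1r. Qed.

Lemma linearP_sub : {morph f : x y / x - y}.
Proof. by move=> x y; rewrite linearP_add linearP_opp. Qed.

Lemma linearP_sum (I : Type) (r : seq I) (P : pred I) (F : I -> V) :
  f (\sum_(i <- r | P i) F i) = \sum_(i <- r | P i) f (F i).
Proof. exact: (big_morph f linearP_add linearP_zero). Qed.

End LinearProp.

(** * Elementary C*-algebra identities *)

Section CStarFacts.
Context {R : realType} {B : cstarType R}.
Implicit Types a b : B.

Lemma cmul_linearr a : linear (cmul a).
Proof. by move=> c x y; rewrite cmulDr cscaleAr. Qed.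

Lemma cmul_linearl b : linear (fun a => a ** b).
Proof. by move=> c x y; rewrite cmulDl cscaleAl. Qed.

Lemma cstar0 : (0 : B)^# = 0.
Proof. by apply: (addrI (0 : B)^#); rewrite -cstarD !addr0. Qed.

Lemma cstarN : {morph (@cstar R B) : a / - a}.
Proof. by move=> a; apply: (addrI a^#); rewrite -cstarD !subrr cstar0. Qed.

Lemma cstar_sum (I : Type) (r : seq I) (P : pred I) (F : I -> B) :
  (\sum_(i <- r | P i) F i)^# = \sum_(i <- r | P i) (F i)^#.
Proof. exact: (big_morph _ (@cstarD R B) cstar0). Qed.

Lemma cstar_mul_eq0 a : a^# ** a = 0 -> a = 0.
Proof.
move=> aa0; apply/eqP; rewrite -normr_eq0 -sqrf_eq0.
by rewrite -cnorm_star aa0 normr0.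
Qed.

End CStarFacts.

(** * Adjointable and compact operators, and representations, for an arbitrary correspondence *)

Section CorrespondenceFacts.
Context {R : realType} {A : cstarType R} {E : correspondence A}.
Implicit Types (xi eta zeta : E) (a : A) (k : E -> E).

Lemma inner_inj xi xi' : (forall eta, inner eta xi = inner eta xi') -> xi = xi'.
Proof.
move=> h; apply/eqP; rewrite -subr_eq0 -normr_eq0 -sqrf_eq0 -inner_norm.
by rewrite (linearP_sub (inner_linear _)) h subrr normr0.
Qed.

Lemma inner_ractl xi a eta : inner (ract xi a) eta = a^# ** inner xi eta.
Proof. by rewrite -inner_star inner_ract cstarM inner_star. Qed.

Lemma inner_suml (I : Type) (r : seq I) (P : pred I) (F : I -> E) eta :
  inner (\sum_(i <- r | P i) F i) eta = \sum_(i <- r | P i) inner (F i) eta.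
Proof.
rewrite -inner_star (linearP_sum (inner_linear _)) cstar_sum.
by apply: eq_bigr => i _; rewrite inner_star.
Qed.

Lemma inner_scalel (c : R[i]) xi eta :
  inner (c *: xi) eta = (c^*)%C *: inner xi eta.
Proof.
by rewrite -inner_star (linearP_scale (inner_linear _)) cstarZ inner_star.
Qed.

Lemma adjoint_ofC k k' : adjoint_of k k' -> adjoint_of k' k.
Proof. by move=> h xi eta; rewrite -inner_star -h inner_star. Qed.

(** Pairing with [zeta] turns [k] into [k'] acting on the other argument, so linearity is inherited
    from [inner], whose values separate vectors. *)
Lemma adjoint_linear k k' : adjoint_of k k' -> linear k.
Proof.
move=> /adjoint_ofC h c xi eta; apply: inner_inj => zeta.
by rewrite -h !inner_linear !h.
Qed.

Lemma adjoint_ract k k' xi a : adjoint_of k k' -> k (ract xi a) = ract (k xi) a.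
Proof.
move=> /adjoint_ofC h; apply: inner_inj => zeta.
by rewrite -h !inner_ract h.
Qed.

Lemma adjoint_lact a : adjoint_of (lact a : E -> E) (lact a^#).
Proof. by move=> xi eta; exact: lact_star. Qed.

Lemma theta_span_compact k : theta_span k -> compact_op k.
Proof.
move=> hk; split; last first.
  move=> e e0; exists k => // zeta; rewrite subrr normr0.
  by rewrite mulr_ge0 ?normr_ge0// lecR ltW.
have [n [c [xi [eta ->]]]] := hk.
exists (fun zeta => \sum_(i < n) (c i)^*%C *: theta (eta i) (xi i) zeta).
move=> zeta omega; rewrite inner_suml (linearP_sum (inner_linear _)).
apply: eq_bigr => i _; rewrite inner_scalel (linearP_scale (inner_linear _)).
by rewrite /theta inner_ractl inner_ract inner_star.
Qed.

Lemma theta_compact xi eta : compact_op (theta xi eta).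
Proof.
apply: theta_span_compact.
exists 1%N, (fun=> 1), (fun=> xi), (fun=> eta).
by apply/funext => zeta; rewrite big_ord1 scale1r.
Qed.

(** The difference [d] of the two sides satisfies [d^# ** T eta = 0] for every [eta]. As [d] is
    itself built from values of [T], this gives [d^# ** d = 0], and the C*-identity forces
    [d = 0]. *)
Lemma representation_ract {B : cstarType R} {T : E -> B} { pi : A -> B}
    (xi : E) (a : A) :
  representation T pi -> T (ract xi a) = T xi ** pi a.
Proof.
move=> [T_lin [pi_lin piM piS] T_inner T_lact].
apply/eqP; rewrite -subr_eq0; apply/eqP/cstar_mul_eq0.
have TT eta : (T (ract xi a) - T xi ** pi a)^# ** T eta = 0.
  rewrite cstarD cstarN (linearP_sub (cmul_linearl _)) cstarM -cmulA !T_inner.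
  by rewrite -piS -piM inner_ractl subrr.
rewrite (linearP_sub (cmul_linearr _)) cmulA !TT.
by rewrite (linearP_zero (cmul_linearl _)) subrr.
Qed.

Lemma induced_hom_sum_theta {B : cstarType R} {T : E -> B} Psi (n : nat)
    (xi eta : 'I_n -> E) : induced_hom T Psi ->
  Psi (fun zeta => \sum_(i < n) theta (xi i) (eta i) zeta) =
  \sum_(i < n) T (xi i) ** (T (eta i))^#.
Proof.
move=> [PsiD _ _ Psi_theta].
elim: n xi eta => [|n IHn] xi eta.
  have sp0 : compact_op (fun zeta : E => \sum_(i < 0) theta (xi i) (eta i) zeta).
    apply: theta_span_compact; exists 0%N, (fun=> 1), xi, eta.
    by apply/funext => zeta; rewrite !big_ord0.
  (* The linearity clause at coefficient -1 yields the value zero of [Psi] at the zero operator. *)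
  have := PsiD (-1) _ _ sp0 sp0; rewrite scaleN1r addNr big_ord0 => <-.
  by congr Psi; apply/funext => zeta; rewrite big_ord0 scaler0 addr0.
rewrite big_ord_recl -Psi_theta -IHn -[X in X + _]scale1r -PsiD.
- by congr Psi; apply/funext => zeta; rewrite big_ord_recl scale1r.
- exact: theta_compact.
- apply: theta_span_compact.
  exists n, (fun=> 1), (fun i => xi (lift ord0 i)), (fun i => eta (lift ord0 i)).
  by apply/funext => zeta; apply: eq_bigr => i _; rewrite scale1r.
Qed.

End CorrespondenceFacts.

(** * Correspondences with a finite orthonormal basis *)

Section OrthonormalBasis.
Context {R : realType} {A : cstarType R} {E : correspondence A}.
Context {e : A} (mul_e : forall a, a ** e = a).
Context {n : nat} {u : 'I_n -> E} (u_basis : orthonormal_basis e u).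
Context (lact_u : forall i, lact e (u i) = u i).

Lemma adjoint_expand (k k' : E -> E) xi : adjoint_of k k' ->
  k xi = \sum_(i < n) ract (k (u i)) (inner (u i) xi).
Proof.
move=> kk'; rewrite {1}(u_basis.1 xi) (linearP_sum (adjoint_linear _ _ kk')).
by apply: eq_bigr => i _; rewrite (adjoint_ract _ _ _ _ kk').
Qed.

Lemma adjoint_theta (k k' : E -> E) : adjoint_of k k' ->
  k = fun zeta => \sum_(i < n) theta (k (u i)) (u i) zeta.
Proof. by move=> kk'; apply/funext => xi; rewrite {1}(adjoint_expand _ _ _ kk'). Qed.

Lemma adjoint_compact (k k' : E -> E) : adjoint_of k k' -> compact_op k.
Proof.
move=> kk'; apply: theta_span_compact.
exists n, (fun=> 1), (k \o u), u; rewrite {1}(adjoint_theta _ _ kk').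
by apply/funext => zeta; apply: eq_bigr => i _; rewrite scale1r.
Qed.

(** An adjointable operator is determined by its values on the basis. For a quiver these values are
    computed pointwise, because the basis comes from C_c(E). *)
Lemma lact_unit (xi : E) : lact e xi = xi.
Proof.
rewrite (adjoint_expand _ _ _ (adjoint_lact e)) [RHS](u_basis.1 xi).
by apply: eq_bigr => i _; rewrite lact_u.
Qed.

Lemma ract_unit (xi : E) : ract xi e = xi.
Proof. by apply: inner_inj => eta; rewrite inner_ract mul_e. Qed.

Lemma generated_moduleT : generated_module (range u) = setT.
Proof.
apply/seteqP; split=> // xi _ D uD D0 D_lin _ D_ract.
rewrite (u_basis.1 xi); apply: big_ind => // [x y Dx Dy|i _].
  by rewrite -[x]scale1r; exact: D_lin.
by apply: D_ract; apply: uD; exists i.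
Qed.

Lemma katsura_idealT :
  injective (@lact R A E) -> @katsura_ideal R A E = setT.
Proof.
move=> lact_inj; apply/seteqP; split=> // a _; split.
  exact: adjoint_compact (adjoint_lact a).
move=> b b0; suff -> : b = 0 by exact: (linearP_zero (cmul_linearr _)).
apply: lact_inj; apply/funext => xi.
by rewrite (b0 xi) (linearP_zero (lact_linear xi)).
Qed.

(** * The induced homomorphism in terms of the basis, and coisometry *)

Section InducedHom.
Context {B : cstarType R} {T : E -> B} { pi : A -> B}.
Hypothesis Tpi : representation T pi.

Definition basis_hom (k : E -> E) : B :=
  \sum_(i < n) T (k (u i)) ** (T (u i))^#.

Lemma representation_expand xi :
  T xi = \sum_(i < n) T (u i) ** pi (inner (u i) xi).
Proof.
have [T_lin _ _ _] := Tpi.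
rewrite {1}(u_basis.1 xi) (linearP_sum T_lin).
by apply: eq_bigr => i _; rewrite (representation_ract _ _ Tpi).
Qed.

Lemma representation_star_expand xi :
  (T xi)^# = \sum_(i < n) pi (inner xi (u i)) ** (T (u i))^#.
Proof.
have [_ [_ _ piS] _ _] := Tpi.
rewrite representation_expand cstar_sum.
by apply: eq_bigr => i _; rewrite cstarM -piS inner_star.
Qed.

(** Each [(T (u i))^# ** T xi] collapses to [pi (inner (u i) xi)], which leaves the basis expansion
    of [T (k xi)]. The trailing factor [b] lets the identity apply to the summands
    [T (l (u i)) ** (T (u i))^#] of [basis_hom l]. *)
Lemma basis_hom_mul (k k' : E -> E) b : adjoint_of k k' ->
  forall xi, basis_hom k ** (T xi ** b) = T (k xi) ** b.
Proof.
move=> kk' xi; have [T_lin _ T_inner _] := Tpi.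
rewrite cmulA (linearP_sum (cmul_linearl _)); congr (_ ** _).
rewrite [in RHS](adjoint_expand _ _ _ kk') (linearP_sum T_lin).
by apply: eq_bigr => i _; rewrite (representation_ract _ _ Tpi) -cmulA T_inner.
Qed.

Lemma basis_hom_induced : induced_hom T basis_hom.
Proof.
have [T_lin [pi_lin piM piS] T_inner T_lact] := Tpi.
split.
- move=> c k l _ _; rewrite /basis_hom scaler_sumr -big_split /=.
  by apply: eq_bigr => i _; rewrite T_lin cmul_linearl.
- move=> k l [[k' kk'] _] _; rewrite [in RHS]/basis_hom.
  rewrite (linearP_sum (cmul_linearr _)); apply: eq_bigr => i _.
  by rewrite (basis_hom_mul _ _ _ kk').
- move=> k k' _ _ kk'; rewrite /basis_hom cstar_sum.
  (* Both sides become a double sum of [T (u j) ** pi c ** (T (u i))^#], with [c] equal to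
     [inner (u j) (k' (u i))] on the left and [inner (k (u j)) (u i)] on the right. *)
  under eq_bigr do rewrite representation_expand (linearP_sum (cmul_linearl _)).
  rewrite exchange_big; apply: eq_bigr => j _.
  rewrite cstarM cstarK representation_star_expand (linearP_sum (cmul_linearr _)).
  by apply: eq_bigr => i _; rewrite -kk' cmulA.
- move=> xi eta; rewrite representation_star_expand (linearP_sum (cmul_linearr _)).
  by apply: eq_bigr => i _; rewrite /theta (representation_ract _ _ Tpi) cmulA.
Qed.

(** Even on the zero ideal, coisometry asks for some induced homomorphism to exist; [basis_hom]
    supplies it. *)
Lemma coisometric0 : coisometric [set 0] T pi.
Proof.
have [T_lin [pi_lin _ _] _ _] := Tpi.
exists basis_hom; first exact: basis_hom_induced.
move=> _ ->; rewrite (linearP_zero pi_lin); apply: big1 => i _.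
rewrite (linearP_zero (lact_linear _)) (linearP_zero T_lin).
exact: (linearP_zero (cmul_linearl _)).
Qed.

Lemma coisometricTP :
  coisometric setT T pi <-> \sum_(i < n) T (u i) ** (T (u i))^# = pi e.
Proof.
have [T_lin [_ piM _] _ T_lact] := Tpi; split=> [[Psi hPsi Psi_lact]|sumT].
  (* Here [Psi] is arbitrary, so its value at [lact e], the identity operator, is read off from the
     expansion into [theta] operators. *)
  rewrite -(Psi_lact e)// (adjoint_theta _ _ (adjoint_lact e)).
  rewrite (induced_hom_sum_theta _ _ _ _ hPsi).
  by apply: eq_bigr => i _; rewrite lact_unit.
exists basis_hom; first exact: basis_hom_induced.
move=> a _; rewrite -[in RHS](mul_e a) piM -sumT (linearP_sum (cmul_linearr _)).
by apply: eq_bigr => i _; rewrite T_lact cmulA.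
Qed.

End InducedHom.

(** * Generators and relations against representations *)

Lemma toeplitz_relationsP (B : cstarType R) (pi : A -> B) (T : E -> B) :
  toeplitz_relations e u B pi T <-> representation T pi.
Proof.
rewrite /toeplitz_relations generated_moduleT; split; last first.
  move=> Tpi; have [T_lin pi_hom T_inner T_lact] := Tpi; split=> //.
  - by move=> al be xi eta _ _; rewrite T_lin (linearP_scale T_lin).
  - by move=> a b xi _; rewrite T_lact (representation_ract _ _ Tpi) cmulA.
  - by move=> i j; rewrite T_inner u_basis.2.
move=> [pi_hom T_lin' T_bimod T_u]; have [pi_lin piM piS] := pi_hom.
(* Since [e] is a right unit, [e^#] equals [e^# ** e], which is self-adjoint. *)
have e_star : e^# = e by rewrite -[e^#]mul_e -{2}[e]cstarK -cstarM mul_e cstarK.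
have T_lin : linear T.
  by move=> c xi eta; rewrite -[eta]scale1r T_lin' // !scale1r.
(* Although [pi e] may fail to be a unit of [B], relation (2) with [a = b = e] makes it act as one
   on both sides of [T xi]. This splits relation (2) into a left and a right module identity. *)
have Te xi : T xi ** pi e = T xi.
  by have := T_bimod e e xi I; rewrite ract_unit lact_unit => <-;
     rewrite -cmulA -piM mul_e.
have eT xi : pi e ** T xi = T xi.
  by have := T_bimod e e xi I; rewrite -cmulA Te ract_unit lact_unit.
have T_ract xi a : T (ract xi a) = T xi ** pi a.
  by have := T_bimod e a xi I; rewrite eT lact_unit => <-.
have T_exp xi : T xi = \sum_(i < n) T (u i) ** pi (inner (u i) xi).
  rewrite {1}(u_basis.1 xi) (linearP_sum T_lin).
  by apply: eq_bigr => i _; rewrite T_ract.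
split=> // [xi eta|a xi]; last first.
  by have := T_bimod a e xi I; rewrite -cmulA Te ract_unit => ->.
(* By relation (3) only the term of index [i] survives in the expansion of [T eta]; the resulting
   factor [e] is absorbed into [u i]. Expanding [xi] afterwards reduces the general inner product to
   this case. *)
have T_ui i : (T (u i))^# ** T eta = pi (inner (u i) eta).
  rewrite (T_exp eta) (linearP_sum (cmul_linearr _)) (bigD1 i)//= big1 => [|j ji].
    rewrite addr0 cmulA T_u eqxx scale1r -piM -[in RHS](ract_unit (u i)).
    by rewrite inner_ractl e_star.
  rewrite cmulA T_u eq_sym (negPf ji) scale0r (linearP_zero pi_lin).
  exact: (linearP_zero (cmul_linearl _)).
rewrite (T_exp xi) cstar_sum (linearP_sum (cmul_linearl _)).
rewrite [X in pi (inner X _)](u_basis.1 xi) inner_suml (linearP_sum pi_lin).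
by apply: eq_bigr => i _; rewrite cstarM -cmulA T_ui inner_ractl piM piS.
Qed.

(** By [relP] both sides admit the same pairs of maps into each target, and the generated module is
    all of [E]. The two universal properties then differ only in the order of their clauses. *)
Lemma universal_iff (K : set A)
    (rel : forall B : cstarType R, (A -> B) -> (E -> B) -> Prop)
    (O : cstarType R) (T : E -> O) (pi : A -> O) :
  (forall (B : cstarType R) (pi : A -> B) (T : E -> B),
     rel B pi T <-> representation T pi /\ coisometric K T pi) ->
  is_relative_cuntz_pimsner K T pi <->
  is_universal_algebra (generated_module (range u)) rel pi T.
Proof.
move=> relP; rewrite /is_universal_algebra generated_moduleT.
have swap (B : cstarType R) (T' : E -> B) pi' (rho : O -> B) :
    [/\ star_hom rho, forall xi, rho (T xi) = T' xi
      & forall a, rho (pi a) = pi' a] <->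
    [/\ star_hom rho, forall a, rho (pi a) = pi' a
      & forall xi, setT xi -> rho (T xi) = T' xi].
  by split=> [[? hT ?]|[? ? hT]]; split=> // xi; exact: hT.
split=> [[Tpi TK Tgen Tuniv]|[/relP[Tpi TK] Tgen Tuniv]]; split=> //.
- exact/relP.
- by rewrite setUC.
- move=> B pi' T' /relP[Tpi' TK'].
  have [rho [/swap h uniq]] := Tuniv B T' pi' Tpi' TK'.
  by exists rho; split=> // rho' /swap; exact: uniq.
- by rewrite setUC.
- move=> B T' pi' Tpi' TK'.
  have [|rho [/swap h uniq]] := Tuniv B pi' T'; first exact/relP.
  by exists rho; split=> // rho' /swap; exact: uniq.
Qed.

End OrthonormalBasis.

Theorem theorem2p18 (R : realType) (Q : topological_quiver R)
    (cX : compact [set: vertex Q])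
    (EQ : correspondence (C0 R (vertex Q))) (iota : (edge Q -> R[i]) -> EQ)
    (hEQ : is_quiver_correspondence iota)
    (n : nat) (u : 'I_n -> edge Q -> R[i])
    (u_Cc : forall i, Cc (u i))
    (u_basis : orthonormal_basis (C0_one R cX) (fun i => iota (u i)))
    (phi_inj : injective (@lact R (C0 R (vertex Q)) EQ)) :
  (forall (O : cstarType R) (T : EQ -> O) (pi : C0 R (vertex Q) -> O),
     is_cuntz_pimsner T pi <->
     is_universal_algebra
       (generated_module (range (fun i => iota (u i))))
       (cuntz_relations (C0_one R cX) (fun i => iota (u i))) pi T) /\
  (forall (O : cstarType R) (T : EQ -> O) (pi : C0 R (vertex Q) -> O),
     is_toeplitz_pimsner T pi <->
     is_universal_algebra
       (generated_module (range (fun i => iota (u i))))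
       (toeplitz_relations (C0_one R cX) (fun i => iota (u i))) pi T).
Proof.
have mul_e (a : C0 R (vertex Q)) : a ** C0_one R cX = a.
  by apply: C0_eq => x; exact: mulr1.
have lact_u i : lact (C0_one R cX) (iota (u i)) = iota (u i).
  rewrite (iota_lact hEQ)//; congr iota.
  by apply/funext => x; exact: mul1r.
have katsuraT := katsura_idealT u_basis phi_inj.
split=> O T pi.
  apply: (universal_iff u_basis) => B pi' T'.
  rewrite katsuraT /cuntz_relations (toeplitz_relationsP mul_e u_basis lact_u).
  by split=> -[Tpi] /(coisometricTP mul_e u_basis lact_u Tpi).
apply: (universal_iff u_basis) => B pi' T'.
rewrite (toeplitz_relationsP mul_e u_basis lact_u).
by split=> [Tpi|[]//]; split=> //; exact: (coisometric0 u_basis).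
Qed.
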